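(* Let $n \ge 1$ and $k \ge 0$ be integers. The assignment $f \colon \{0,\dots,n+k-1\}\to\{0,\dots,n-1\}$, $f(i)=i\bmod n$, determines a simplicial, surjective homotopy equivalence \[ f \colon \overline{\mathcal{N}}(n+k,k) \xrightarrow{\ \simeq\ } \mathcal{N}(n,k). \]
   Context: For $n\ge1$ and integers $i\le j$, $[i,j]_n$ is the image of $\{i,i+1,\dots,j\}$ under $\mathbb{Z}\to\mathbb{Z}/n$. For $n\ge1$, $k\ge0$, the nerve complex $\mathcal{N}(n,k)$ is the simplicial complex with vertex set $\{0,\dots,n-1\}$ (identified with $\mathbb{Z}/n$) whose maximal simplices are the sets $[i,i+k]_n$, $i=0,\dots,n-1$. The clique complex $\overline{\mathcal{N}}(n,k)$ is the clique complex of the $1$-skeleton of $\mathcal{N}(n,k)$: its vertex set is $\{0,\dots,n-1\}$ and its simplices are the vertex sets that are pairwise adjacent in that $1$-skeleton. Simplicial complexes are identified with their geometric realizations. *)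

(* Defs.v *)
From HB Require Import structures.
From mathcomp Require Import all_boot all_order all_algebra.
From mathcomp Require Import all_classical all_reals all_analysis.
Import Order.TTheory GRing.Theory Num.Theory.
Import numFieldNormedType.Exports.

Set Implicit Arguments.
Unset Strict Implicit.
Unset Printing Implicit Defensive.

Local Open Scope ring_scope.

(* Abstract simplicial complexes with vertex set the whole of the finite type
   [V]. The empty face is allowed; it contributes nothing to the geometric
   realization. *)
Record scomplex (V : finType) := SComplex {
  simplices :> {set {set V}};
  vertex_simplex : forall v, [set v]%SET \in simplices;
  face_simplex : forall s t : {set V},
    t \subset s -> s \in simplices -> t \in simplices
}.

Definition simplicial_map (V W : finType) (K : scomplex V) (L : scomplex W)
    (f : V -> W) : Prop :=
  forall s : {set V}, s \in K -> (f @: s)%SET \in L.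

Definition skeleton1 (V : finType) (K : scomplex V) : rel V :=
  fun u v => (u != v) && ([set u; v]%SET \in K).

Definition clique_simplices (V : finType) (e : rel V) : {set {set V}} :=
  [set s : {set V} | [forall u in s, forall v in s, (u != v) ==> e u v]]%SET.

Lemma clique_vertex (V : finType) (e : rel V) (v : V) :
  [set v]%SET \in clique_simplices e.
Proof.
rewrite inE; apply/forall_inP => u /set1P ->.
by apply/forall_inP => w /set1P ->; rewrite eqxx.
Qed.

Lemma clique_face (V : finType) (e : rel V) (s t : {set V}) :
  t \subset s -> s \in clique_simplices e -> t \in clique_simplices e.
Proof.
move=> /fintype.subsetP ts; rewrite !inE => /forall_inP hs.
apply/forall_inP => u /ts /hs /forall_inP hu.
by apply/forall_inP => v /ts /hu.
Qed.

Definition clique_complex (V : finType) (e : rel V) : scomplex V :=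
  SComplex (clique_vertex e) (@clique_face V e).

(* [i,j]_n, the image of {i, ..., j} in Z/n, where the residue classes are
   represented by ['I_n]. *)
Definition circ_arc (n i j : nat) : {set 'I_n} :=
  [set v : 'I_n | has (fun m => m == v %[mod n])%N (index_iota i j.+1)]%SET.

(* The arcs [i,i+k]_n all have the same cardinality, so they are exactly the
   maximal elements of the family of their subsets. *)
Definition nerve_simplices (n k : nat) : {set {set 'I_n}} :=
  [set s : {set 'I_n} | [exists i : 'I_n, s \subset circ_arc n i (i + k)]]%SET.

Lemma nerve_vertex (n k : nat) (v : 'I_n) : [set v]%SET \in nerve_simplices n k.
Proof.
rewrite inE; apply/existsP; exists v; rewrite finset.sub1set inE.
apply/hasP; exists (v : nat) => //.
by rewrite mem_index_iota leqnn ltnS leq_addr.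
Qed.

Lemma nerve_face (n k : nat) (s t : {set 'I_n}) :
  t \subset s -> s \in nerve_simplices n k -> t \in nerve_simplices n k.
Proof.
move=> ts; rewrite !inE => /existsP[i si]; apply/existsP; exists i.
exact: fintype.subset_trans ts si.
Qed.

Definition nerve (n k : nat) : scomplex 'I_n :=
  SComplex (@nerve_vertex n k) (@nerve_face n k).

Definition clique_nerve (n k : nat) : scomplex 'I_n :=
  clique_complex (skeleton1 (nerve n k)).

Definition residue (m n : nat) (n_gt0 : (0 < n)%N) (i : 'I_m) : 'I_n :=
  Ordinal (ltn_pmod i n_gt0).

Local Open Scope classical_set_scope.

(* The points are the barycentric coordinate vectors; for a finite complex the
   topology of the realization is the subspace topology of R^m. *)
Definition realization (R : realType) (m : nat) (K : scomplex 'I_m) :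
    set 'rV[R]_m :=
  [set x | [/\ forall i, 0 <= x 0 i,
               \sum_i x 0 i = 1
             & [set i | x 0 i != 0]%SET \in K]].

Arguments realization R [m] K.

(* The affine extension of a vertex map, on barycentric coordinates. *)
Definition realization_map (R : realType) (m n : nat) (f : 'I_m -> 'I_n)
    (x : 'rV[R]_m) : 'rV[R]_n :=
  \row_j \sum_(i | f i == j) x 0 i.

Section Homotopy.
Variable R : realType.

(* Subspaces A of X and B of Y are treated as spaces; maps A -> B are
   represented by functions X -> Y, whose values outside A are irrelevant. *)

Definition continuous_map (X Y : topologicalType) (A : set X) (B : set Y)
    (f : X -> Y) : Prop :=
  set_fun A B f /\ {within A, continuous f}.

Definition homotopic (X Y : topologicalType) (A : set X) (B : set Y)
    (f g : X -> Y) : Prop :=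
  exists H : R * X -> Y,
    [/\ continuous_map ((`[0, 1] : set R) `*` A) B H,
        forall x, A x -> H (0, x) = f x
      & forall x, A x -> H (1, x) = g x].

Definition homotopy_equivalence (X Y : topologicalType) (A : set X) (B : set Y)
    (f : X -> Y) : Prop :=
  continuous_map A B f /\
  exists g : Y -> X,
    [/\ continuous_map B A g,
        homotopic A A (g \o f) id
      & homotopic B B (f \o g) id].

End Homotopy.

(* Main.v *)
Require Import Defs.
From mathcomp Require Import all_boot all_order all_algebra.
From mathcomp Require Import all_classical all_reals all_analysis.
From mathcomp Require Import zify.
Import Order.TTheory GRing.Theory Num.Theory.
Import numFieldNormedType.Exports.

(** Two facts carry the proof. The first is combinatorial: over every nonempty
    simplex s of N(n,k) the fiber of f, that is the full subcomplex on the
    vertices which f maps into s, is a cone inside the clique complex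
    ([residue_fiber_apex]). Say s is contained in an arc [i,i+k]_n. If the part
    of s that comes after the arc has passed n is nonempty and has largest
    element b, the apex is b+n; otherwise it is the least element of s.

    The second is a version of Quillen's fiber lemma in which the homotopy
    inverse is explicit ([conical_fibers_equivalence]). Let f : K -> L be
    simplicial, K flag, and let the fiber over each nonempty simplex s of L be a
    cone with an apex p(s) lying over s. A point y of |L| is an integral over
    the levels c of the indicators of its superlevel sets, which form a chain of
    simplices of L. Replacing every superlevel set s by the vertex p(s) and
    normalizing gives g(y). The vertices used are pairwise adjacent: if s is
    contained in t, then p(s) lies in the fiber over t, of which p(t) is an
    apex. Since K is flag, g(y) is a point of |K|.

    The composite f(g(y)) is supported in the support of y, so a segment in |L|
    joins it to y. For g(f(x)) a moving level c joins it to x: keep of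
    x the part above c, that is the coordinates max(0, x_v - c), and of g(f(x))
    the contribution of the levels below c. A vertex v with x_v > c has an image
    of weight more than c in f(x), hence lies in the fiber over each superlevel
    set of level below c, and so it is adjacent to the corresponding apexes. At
    c = 0 this is x, at c = 1 it is g(f(x)). *)

Set Implicit Arguments.
Unset Strict Implicit.
Unset Printing Implicit Defensive.

Local Open Scope classical_set_scope.
Local Open Scope ring_scope.

(** * Convergence of iterated operations and of row vectors *)

(** The index value [c] of the iterated operation converges as well, as the
    level that caps a minimum varies along a homotopy. *)
Lemma cvg_big_idx (U : topologicalType) (op : U -> U -> U) (I T : Type)
    (r : seq I) (P : pred I) (F : set_system T) {FF : Filter F}
    (c : T -> U) (g : I -> T -> U) (c0 : U) (g0 : I -> U) :
  continuous (fun x : U * U => op x.1 x.2) ->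
  c t @[t --> F] --> c0 ->
  (forall i, P i -> g i t @[t --> F] --> g0 i) ->
  \big[op/c t]_(i <- r | P i) g i t @[t --> F] -->
    \big[op/c0]_(i <- r | P i) g0 i.
Proof.
move=> op_cont c_cvg g_cvg; elim: r => [|i r IHr].
  by rewrite big_nil; under eq_cvg do rewrite big_nil.
rewrite big_cons; under eq_cvg do rewrite big_cons.
case: ifPn => // Pi.
exact: (cvg_comp2 (g_cvg i Pi) IHr (op_cont (_, _))).
Qed.

Lemma cvg_row (R : realType) (m : nat) (T : Type) (F : set_system T)
    {FF : Filter F} (g : T -> 'rV[R]_m) (x : 'rV[R]_m) :
  g t @[t --> F] --> x <-> forall i, g t 0 i @[t --> F] --> x 0 i.
Proof.
split=> [gx i|gx A [P nP PA]].
  exact: (cvg_comp _ _ gx (@coord_continuous _ _ _ 0 i x)).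
have := @filter_forall _ _ (fun i t => P 0 i (g t 0 i)) _ FF
  (fun i => gx i _ (nP 0 i)).
by apply: filterS => t Pt; apply: PA => i j; rewrite ord1.
Qed.

Lemma cvg_sumr (R : realType) (I : finType) (T : Type) (P : pred I)
    (F : set_system T) {FF : Filter F} (g : I -> T -> R) (g0 : I -> R) :
  (forall i, P i -> g i t @[t --> F] --> g0 i) ->
  \sum_(i | P i) g i t @[t --> F] --> \sum_(i | P i) g0 i.
Proof.
move=> gc; apply: (cvg_big_idx _ (cvg_cst _) gc).
exact: add_continuous.
Qed.

Lemma cvg_maxr (R : realType) (T : Type) (F : set_system T) {FF : Filter F}
    (a b : T -> R) (a0 b0 : R) :
  a t @[t --> F] --> a0 -> b t @[t --> F] --> b0 ->
  Num.max (a t) (b t) @[t --> F] --> Num.max a0 b0.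
Proof.
by move=> aa bb; exact: (cvg_comp2 aa bb (@max_continuous _ R (_, _))).
Qed.

(** * Points of geometric realizations *)

Section Realization.
Variable R : realType.

Definition supp m (x : 'rV[R]_m) : {set 'I_m} := [set i | x 0 i != 0]%SET.

Lemma realization_face m (K : scomplex 'I_m) (x : 'rV[R]_m) (s : {set 'I_m}) :
  (forall i, 0 <= x 0 i) -> \sum_i x 0 i = 1 -> s \in K ->
  (forall i, 0 < x 0 i -> i \in s) -> realization R K x.
Proof.
move=> x0 x1 sK xs; split=> //; apply: face_simplex sK.
apply/fintype.subsetP => i; rewrite inE => xi.
by apply: xs; rewrite lt0r xi x0.
Qed.

Lemma realization_supp m (K : scomplex 'I_m) (x : 'rV[R]_m) :
  realization R K x -> supp x \in K.
Proof. by case. Qed.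

Lemma realization_le1 m (K : scomplex 'I_m) (x : 'rV[R]_m) i :
  realization R K x -> x 0 i <= 1.
Proof.
move=> [x0 x1 _]; rewrite -x1 (bigD1 i) //= lerDl; exact: sumr_ge0.
Qed.

Lemma realization_gt0 m (K : scomplex 'I_m) (x : 'rV[R]_m) :
  realization R K x -> exists i, 0 < x 0 i.
Proof.
move=> [x0 x1 _]; apply/existsP; apply: contraT => /existsPn xn.
have := oner_neq0 R; rewrite -x1 big1 ?eqxx // => i _.
by apply/eqP; rewrite eq_le x0 andbT leNgt xn.
Qed.

Lemma realization_convex m (K : scomplex 'I_m) (x y : 'rV[R]_m) (t : R) :
  realization R K x -> realization R K y -> supp x \subset supp y ->
  0 <= t <= 1 -> realization R K ((1 - t) *: x + t *: y).
Proof.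
move=> [x0 x1 _] [y0 y1 yK] /fintype.subsetP xy /andP[t0 t1].
have t1' : 0 <= 1 - t by rewrite subr_ge0.
apply: (realization_face _ _ yK) => [i||i].
- by rewrite !mxE addr_ge0 ?mulr_ge0.
- under eq_bigr do rewrite !mxE.
  by rewrite big_split/= -!mulr_sumr x1 y1 !mulr1 subrK.
- rewrite !mxE => h; apply: contraT => yi; move: h; rewrite inE negbK in yi.
  have xi : x 0 i == 0.
    by apply: contraT => xi; have := xy i; rewrite !inE xi yi => /(_ isT).
  by rewrite (eqP yi) (eqP xi) !mulr0 addr0 ltxx.
Qed.

Section VertexMap.
Variables (m n : nat) (f : 'I_m -> 'I_n).

Lemma realization_map_ge0 (x : 'rV[R]_m) :
  (forall i, 0 <= x 0 i) -> forall j, 0 <= realization_map f x 0 j.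
Proof. by move=> x0 j; rewrite mxE sumr_ge0. Qed.

Lemma realization_map_sum (x : 'rV[R]_m) :
  \sum_j realization_map f x 0 j = \sum_i x 0 i.
Proof.
rewrite [RHS](partition_big f predT) //=.
by apply: eq_bigr => j _; rewrite mxE.
Qed.

Lemma le_realization_map (x : 'rV[R]_m) i :
  (forall i, 0 <= x 0 i) -> x 0 i <= realization_map f x 0 (f i).
Proof.
by move=> x0; rewrite mxE (bigD1 i) //= lerDl sumr_ge0.
Qed.

Lemma realization_map_gt0 (x : 'rV[R]_m) j :
  0 < realization_map f x 0 j -> exists2 i, f i = j & x 0 i != 0.
Proof.
rewrite mxE => h; have /existsP[i /andP[/eqP fi xi]] :
  [exists i, (f i == j) && (x 0 i != 0)]; last by exists i.
apply: contraT => /existsPn xn; move: h; rewrite big1 ?ltxx // => i fi.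
by have := xn i; rewrite fi /= negbK => /eqP.
Qed.

Lemma realization_map_fun (K : scomplex 'I_m) (L : scomplex 'I_n) :
  simplicial_map K L f ->
  set_fun (realization R K) (realization R L) (realization_map f).
Proof.
move=> fKL x [x0 x1 xK]; apply: (realization_face _ _ (fKL _ xK)).
- exact: realization_map_ge0.
- by rewrite realization_map_sum.
- by move=> j /realization_map_gt0[i <- xi]; apply: imset_f; rewrite inE.
Qed.

Lemma cvg_realization_map (T : Type) (F : set_system T) {FF : Filter F}
    (g : T -> 'rV[R]_m) (x : 'rV[R]_m) :
  g t @[t --> F] --> x ->
  realization_map f (g t) @[t --> F] --> realization_map f x.
Proof.
move=> gx; apply/cvg_row => j; rewrite mxE.
under eq_cvg do rewrite mxE.
by apply: cvg_sumr => i _; move/cvg_row: gx.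
Qed.

(** A point of a simplex [f @: s] is lifted by choosing one preimage in [s] for
    each vertex and moving its coordinate there. *)
Lemma realization_map_surj (K : scomplex 'I_m) (L : scomplex 'I_n) :
  (forall t, t \in L -> exists2 s, s \in K & (f @: s = t)%SET) ->
  set_surj (realization R K) (realization R L) (realization_map f).
Proof.
move=> lift y [y0 y1 yL]; have [s sK fs] := lift _ yL.
(* [pick i in s | f i == j] is the chosen preimage of [j]. *)
pose x : 'rV[R]_m := \row_i
  \sum_(j | [pick i in s | f i == j] == Some i) y 0 j.
have x_gt0 i : 0 < x 0 i -> i \in s.
  rewrite mxE => h; apply: contraT => /negP si; move: h.
  rewrite big1 ?ltxx // => j; case: pickP => // i' /andP[si' _] /eqP[ii'].
  by case: si; rewrite -ii'.
have x_ge0 i : 0 <= x 0 i by rewrite mxE sumr_ge0.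
have fx : realization_map f x = y.
  apply/rowP => j; rewrite mxE; under eq_bigr do rewrite mxE.
  rewrite (exchange_big_dep xpredT) //=.
  (* Only [j] contributes, as a chosen preimage of [j'] is mapped to [j']. *)
  rewrite (bigD1 j) //= [X in _ + X]big1 ?addr0 => [|j' jj']; last first.
    rewrite big1 // => i /andP[/eqP fi]; case: pickP => // i' /andP[_ /eqP fi'].
    by move=> /eqP[ii']; rewrite -fi -ii' fi' eqxx in jj'.
  case: pickP => [i /andP[si /eqP fi]|no].
    rewrite (big_pred1 i) // => i' /=; rewrite eq_sym.
    apply/andP/eqP => [[_ /eqP[]]//|->]; rewrite fi; split; exact/eqP.
  rewrite big_pred0 => [|i]; last by rewrite andbF.
  apply/esym/eqP; apply: contraT => yj.
  have: j \in (f @: s)%SET by rewrite fs inE.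
  by move=> /imsetP[i si ji]; have := no i; rewrite /= si ji eqxx.
exists x => //; apply: (realization_face _ _ sK) => //.
by rewrite -realization_map_sum fx.
Qed.

End VertexMap.

Definition normalize m (u : 'rV[R]_m) : 'rV[R]_m := (\sum_i u 0 i)^-1 *: u.

(** The form in which maps into a realization are obtained below: continuous
    nonnegative weights whose supports are simplices. *)
Lemma normalize_realization m (K : scomplex 'I_m) (u : 'rV[R]_m)
    (s : {set 'I_m}) :
  (forall i, 0 <= u 0 i) -> (exists i, 0 < u 0 i) -> s \in K ->
  (forall i, 0 < u 0 i -> i \in s) -> realization R K (normalize u).
Proof.
move=> u0 [i0 ui0] sK us.
have N0 : 0 < \sum_i u 0 i.
  by rewrite (bigD1 i0) //= ltr_pwDl // sumr_ge0.
apply: (realization_face _ _ sK) => [i||i].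
- by rewrite mxE mulr_ge0 // invr_ge0 ltW.
- under eq_bigr do rewrite mxE.
  by rewrite -mulr_sumr mulVf // gt_eqF.
- by rewrite mxE pmulr_rgt0 ?invr_gt0 //; exact: us.
Qed.

Lemma cvg_normalize m (T : Type) (F : set_system T) {FF : Filter F}
    (g : T -> 'rV[R]_m) (u : 'rV[R]_m) :
  (forall i, 0 <= u 0 i) -> (exists i, 0 < u 0 i) ->
  g t @[t --> F] --> u -> normalize (g t) @[t --> F] --> normalize u.
Proof.
move=> u0 [i0 ui0] /cvg_row gu; apply/cvg_row => i.
under eq_cvg do rewrite mxE.
rewrite mxE; apply: cvgM (gu i); apply: cvgV; last exact: cvg_sumr.
by rewrite gt_eqF // (bigD1 i0) //= ltr_pwDl // sumr_ge0.
Qed.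

(** * Weights of superlevel sets *)

Section LevelSets.
Variable n : nat.
Implicit Types (y : 'rV[R]_n) (s : {set 'I_n}).

(** For [0 <= y], the length of the set of levels t in the interval from 0 to
    [c] at which the superlevel set of [y], {j | t < y_j}, is equal to [s]. *)
Definition level_weight (c : R) y s : R :=
  Num.max 0 (\big[Num.min/c]_(j in s) y 0 j -
             \big[Num.max/0]_(j in ~: s) y 0 j).

Lemma level_weight_ge0 c y s : 0 <= level_weight c y s.
Proof. by rewrite le_max lexx. Qed.

Lemma level_weight_gt0P c y s :
  reflect [/\ 0 < c, forall j, j \in s -> 0 < y 0 j,
              forall l, l \notin s -> y 0 l < c
            & forall j l, j \in s -> l \notin s -> y 0 l < y 0 j]
          (0 < level_weight c y s).
Proof.
rewrite lt_max ltxx /= subr_gt0.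
apply: (iffP (bigmin_gtP _ _ _ _)) => [[/bigmax_ltP[c0 yc] ys]|[c0 ys yc yy]].
  split=> // [j /ys/bigmax_ltP[]//|l sl|j l /ys/bigmax_ltP[_ yl] sl].
    by apply: yc; rewrite inE.
  by apply: yl; rewrite inE.
split=> [|j js]; apply/bigmax_ltP; split=> //.
- by move=> l; rewrite inE; exact: yc.
- exact: ys.
- by move=> l; rewrite inE; exact: yy.
Qed.

Lemma level_weight_chain c y s t :
  0 < level_weight c y s -> 0 < level_weight c y t ->
  (s \subset t) || (t \subset s).
Proof.
move=> /level_weight_gt0P[_ _ _ hs] /level_weight_gt0P[_ _ _ ht].
apply: contraT; rewrite negb_or => /andP[].
move=> /fintype.subsetPn[j js jt] /fintype.subsetPn[l lt ls].
by have := lt_trans (hs _ _ js ls) (ht _ _ lt jt); rewrite ltxx.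
Qed.

(** The superlevel set just below the level min(c, max y) is nonempty and occurs
    for an interval of levels. *)
Lemma exists_level_weight_gt0 c y :
  0 < c -> (exists j, 0 < y 0 j) ->
  exists2 s, s != finset.set0 & 0 < level_weight c y s.
Proof.
move=> c0 [j0 yj0].
have [j1 _ ymax] := arg_maxP (fun j => y 0 j) (isT : xpredT j0).
pose d := Num.min c (y 0 j1).
have d0 : 0 < d by rewrite lt_min c0 /=; exact: lt_le_trans yj0 (ymax _ isT).
exists [set j | d <= y 0 j]%SET.
  by apply/finset.set0Pn; exists j1; rewrite inE ge_min lexx orbT.
apply/level_weight_gt0P; split=> // [j|l|j l]; rewrite !inE -?ltNge.
- exact: lt_le_trans.
- by move=> /lt_le_trans; apply; rewrite ge_min lexx.
- by move=> dj ld; exact: lt_le_trans dj.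
Qed.

Lemma cvg_level_weight (T : Type) (F : set_system T) {FF : Filter F}
    (c : T -> R) (g : T -> 'rV[R]_n) c0 y s :
  c t @[t --> F] --> c0 -> g t @[t --> F] --> y ->
  level_weight (c t) (g t) s @[t --> F] --> level_weight c0 y s.
Proof.
move=> cc /cvg_row gy.
apply: cvg_maxr; first exact: cvg_cst.
apply: cvgB; apply: cvg_big_idx => //.
- exact: (@min_continuous _ R).
- exact: (@max_continuous _ R).
- exact: cvg_cst.
Qed.

End LevelSets.
End Realization.

(** * Flag complexes *)

(** The two vertices may be equal: [[set u; u]] is a simplex in any case. *)
Definition flag (V : finType) (K : scomplex V) : Prop :=
  forall s : {set V},
    {in s &, forall u v, [set u; v]%SET \in K} -> s \in K.

Lemma clique_complexP (V : finType) (K : scomplex V) (s : {set V}) :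
  reflect {in s &, forall u v, [set u; v]%SET \in K}
          (s \in clique_complex (skeleton1 K)).
Proof.
rewrite inE; apply: (iffP forall_inP) => [h u v su sv|h u su].
  have [->|uv] := eqVneq u v; first by rewrite finset.setUid vertex_simplex.
  by have /forall_inP/(_ v sv) := h u su; rewrite uv => /andP[].
by apply/forall_inP => v sv; apply/implyP => uv; rewrite /skeleton1 uv h.
Qed.

(** Passing to the clique complex does not change the 1-skeleton. *)
Lemma clique_complex_edge (V : finType) (K : scomplex V) u v :
  ([set u; v]%SET \in clique_complex (skeleton1 K)) = ([set u; v]%SET \in K).
Proof.
apply/clique_complexP/idP => [h|uvK a b].
  by apply: h; rewrite !inE eqxx ?orbT.
rewrite !inE => ha hb; apply: face_simplex uvK; apply/fintype.subsetP => w.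
by rewrite !inE => /orP[]/eqP->.
Qed.

Lemma clique_complex_flag (V : finType) (K : scomplex V) :
  flag (clique_complex (skeleton1 K)).
Proof.
move=> s h; apply/clique_complexP => u v su sv.
by rewrite -clique_complex_edge h.
Qed.

(** * Simplicial maps with conical fibers *)

(** The choice function [p] selects an apex of the fiber over each simplex. Maps
    and homotopies result from it by placing at [p s] the weight of the
    superlevel set [s]. *)
Section ConicalFibers.
Variables (R : realType) (m n : nat).
Variables (K : scomplex 'I_m) (L : scomplex 'I_n) (f : 'I_m -> 'I_n).
Variable p : {set 'I_n} -> 'I_m.
Implicit Types (c : R) (x : 'rV[R]_m) (y : 'rV[R]_n) (s : {set 'I_n}).
Hypothesis K_flag : flag K.
Hypothesis f_simplicial : simplicial_map K L f.
Hypothesis f_apex :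
  forall s, s \in L -> s != finset.set0 -> f (p s) \in s.
Hypothesis apex_adj :
  forall s v, s \in L -> f v \in s -> [set v; p s]%SET \in K.

Definition apex_weights (c : R) (y : 'rV[R]_n) : 'rV[R]_m :=
  \row_v \sum_(s : {set 'I_n} | (s != finset.set0) && (p s == v))
    level_weight c y s.

Lemma apex_weights_ge0 c y v : 0 <= apex_weights c y 0 v.
Proof. by rewrite mxE sumr_ge0 // => s _; exact: level_weight_ge0. Qed.

Lemma apex_weights_gt0P c y v :
  0 < apex_weights c y 0 v <->
  exists s, [/\ s != finset.set0, p s = v & 0 < level_weight c y s].
Proof.
split=> [|[s [s0 psv ws]]]; rewrite mxE.
  move=> h; have /existsP[s /and3P[s0 /eqP ps ws]] : [exists s : {set 'I_n},
    [&& s != finset.set0, p s == v & 0 < level_weight c y s]]; last by exists s.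
  apply: contraT => /existsPn ns; move: h.
  rewrite big1 ?ltxx // => s /andP[s0 ps].
  apply/eqP; rewrite eq_le level_weight_ge0 andbT leNgt.
  by have := ns s; rewrite s0 ps.
rewrite (bigD1 s) /= ?s0 ?psv ?eqxx // ltr_pwDl // sumr_ge0 // => t _.
exact: level_weight_ge0.
Qed.

Lemma cvg_apex_weights (T : Type) (F : set_system T) {FF : Filter F}
    (c : T -> R) (g : T -> 'rV[R]_n) c0 y :
  c t @[t --> F] --> c0 -> g t @[t --> F] --> y ->
  apex_weights (c t) (g t) @[t --> F] --> apex_weights c0 y.
Proof.
move=> cc gy; apply/cvg_row => v; under eq_cvg do rewrite mxE.
by rewrite mxE; apply: cvg_sumr => s _; exact: cvg_level_weight.
Qed.

Lemma exists_apex_weight_gt0 c y :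
  0 < c -> (exists j, 0 < y 0 j) -> exists v, 0 < apex_weights c y 0 v.
Proof.
move=> c0 /(exists_level_weight_gt0 c0)[s s0 ws].
by exists (p s); apply/apex_weights_gt0P; exists s.
Qed.

Lemma level_set_in c y s :
  realization R L y -> 0 < level_weight c y s -> s \in L.
Proof.
move=> /realization_supp yL /level_weight_gt0P[_ ys _ _].
apply: face_simplex yL; apply/fintype.subsetP => j /ys.
by rewrite inE; exact: lt0r_neq0.
Qed.

(** Superlevel sets form a chain, and for [s] inside [t] the apex of [s] lies
    over [t], so that the apex of [t] is adjacent to it. *)
Lemma apexes_adj c y u v : realization R L y ->
  0 < apex_weights c y 0 u -> 0 < apex_weights c y 0 v ->
  [set u; v]%SET \in K.
Proof.
move=> yL /apex_weights_gt0P[s [s0 <- ws]] /apex_weights_gt0P[t [t0 <- wt]].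
have sL := level_set_in yL ws; have tL := level_set_in yL wt.
have /orP[/fintype.subsetP st|/fintype.subsetP ts] := level_weight_chain ws wt.
  by apply: apex_adj => //; apply/st/f_apex.
by rewrite finset.setUC; apply: apex_adj => //; apply/ts/f_apex.
Qed.

Definition homotopy_inverse (y : 'rV[R]_n) : 'rV[R]_m :=
  normalize (apex_weights 1 y).

Lemma homotopy_inverse_fun :
  set_fun (realization R L) (realization R K) homotopy_inverse.
Proof.
move=> y yL.
apply: (@normalize_realization _ _ _ _ [set v | 0 < apex_weights 1 y 0 v]%SET).
- exact: apex_weights_ge0.
- by apply: exists_apex_weight_gt0 => //; exact: realization_gt0 yL.
- by apply: K_flag => u v; rewrite !inE; exact: apexes_adj.
- by move=> v; rewrite inE.
Qed.

Lemma cvg_homotopy_inverse (T : Type) (F : set_system T) {FF : Filter F}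
    (g : T -> 'rV[R]_n) y : realization R L y ->
  g t @[t --> F] --> y ->
  homotopy_inverse (g t) @[t --> F] --> homotopy_inverse y.
Proof.
move=> yL gy; apply: cvg_normalize.
- exact: apex_weights_ge0.
- by apply: exists_apex_weight_gt0 => //; exact: realization_gt0 yL.
- by apply: cvg_apex_weights => //; exact: cvg_cst.
Qed.

(** Each apex lies over a vertex of a superlevel set of [y]. Hence a point and
    its image under the composite lie in a common simplex. *)
Lemma homotopy_inverse_supp y : realization R L y ->
  supp (realization_map f (homotopy_inverse y)) \subset supp y.
Proof.
move=> yL.
have [v0 _ _] := realization_map_fun f_simplicial (homotopy_inverse_fun yL).
apply/fintype.subsetP => j; rewrite [in X in X -> _]inE => hj.
have /realization_map_gt0[v <- hv] :
    0 < realization_map f (homotopy_inverse y) 0 j.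
  by rewrite lt0r hj v0.
move: hv; rewrite mxE mulf_eq0 negb_or => /andP[_ hv].
have /apex_weights_gt0P[s [s0 <- ws]] : 0 < apex_weights 1 y 0 v.
  by rewrite lt0r hv apex_weights_ge0.
have fps := f_apex (level_set_in yL ws) s0.
move/level_weight_gt0P: ws => [_ ys _ _].
by rewrite inE lt0r_neq0 // ys.
Qed.

Definition truncation (c : R) (x : 'rV[R]_m) : 'rV[R]_m :=
  \row_v Num.max 0 (x 0 v - c).

Lemma truncation_gt0 c x v : (0 < truncation c x 0 v) = (c < x 0 v).
Proof. by rewrite mxE lt_max ltxx /= subr_gt0. Qed.

Lemma truncation_ge0 c x v : 0 <= truncation c x 0 v.
Proof. by rewrite mxE le_max lexx. Qed.

(** The levels of [x] above [c] stay in place, while the levels of its image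
    below [c] have been moved to the apexes. *)
Definition cone_weights (c : R) (x : 'rV[R]_m) : 'rV[R]_m :=
  truncation c x + apex_weights c (realization_map f x).

Lemma cone_weights_ge0 c x v : 0 <= cone_weights c x 0 v.
Proof. by rewrite mxE addr_ge0 // ?truncation_ge0 ?apex_weights_ge0. Qed.

(** The first summand is nonzero at [c = 0], the second one for [0 < c]. *)
Lemma exists_cone_weight_gt0 c x : 0 <= c -> realization R K x ->
  exists v, 0 < cone_weights c x 0 v.
Proof.
rewrite le_eqVlt => /orP[/eqP<-|c0] xK.
  have [v xv] := realization_gt0 xK; exists v.
  by rewrite mxE ltr_pwDl ?apex_weights_ge0 // truncation_gt0.
have [v hv] := exists_apex_weight_gt0 c0
  (realization_gt0 (realization_map_fun f_simplicial xK)).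
by exists v; rewrite mxE ltr_wpDl ?truncation_ge0.
Qed.

(** The homotopy stays in [K]: the only new adjacency needed is that of a vertex
    [a] with [c < x_a] to the apex of a superlevel set [s] of level below [c].
    The coordinate of the image at [f a] is at least [x_a], so that [f a] is in
    [s]. *)
Lemma cone_weights_clique c x u v : 0 <= c -> realization R K x ->
  0 < cone_weights c x 0 u -> 0 < cone_weights c x 0 v -> [set u; v]%SET \in K.
Proof.
move=> c0 xK; have [x0 _ sK] := xK.
have yL := realization_map_fun f_simplicial xK.
have split_pos w : 0 < cone_weights c x 0 w ->
    c < x 0 w \/ 0 < apex_weights c (realization_map f x) 0 w.
  rewrite mxE => h; have [|xw] := ltP c (x 0 w); first by left.
  right; move: h; have -> : truncation c x 0 w = 0; last by rewrite add0r.
  by apply/eqP; rewrite eq_le truncation_ge0 andbT leNgt truncation_gt0 -leNgt.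
have mixed a b : c < x 0 a -> 0 < apex_weights c (realization_map f x) 0 b ->
    [set a; b]%SET \in K.
  move=> xa /apex_weights_gt0P[s [s0 <- ws]]; apply: apex_adj.
    exact: level_set_in ws.
  move/level_weight_gt0P: ws => [_ _ ys _]; apply: contraT => /ys.
  by rewrite ltNge (le_trans (ltW xa)) // le_realization_map.
move=> /split_pos[xu|pu] /split_pos[xv|pv].
- apply: face_simplex sK; apply/fintype.subsetP => w; rewrite !inE.
  by move=> /orP[]/eqP->; rewrite lt0r_neq0 // (le_lt_trans c0).
- exact: mixed.
- by rewrite finset.setUC; exact: mixed.
- exact: apexes_adj pu pv.
Qed.

Lemma cvg_cone_weights (T : Type) (F : set_system T) {FF : Filter F}
    (c : T -> R) (g : T -> 'rV[R]_m) c0 x :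
  c t @[t --> F] --> c0 -> g t @[t --> F] --> x ->
  cone_weights (c t) (g t) @[t --> F] --> cone_weights c0 x.
Proof.
move=> cc gx; apply: cvgD; last first.
  by apply: cvg_apex_weights => //; exact: cvg_realization_map.
apply/cvg_row => v; under eq_cvg do rewrite mxE.
rewrite mxE.
apply: cvg_maxr; first exact: cvg_cst.
by apply: cvgB => //; move/cvg_row: gx.
Qed.

Lemma cone_weights0 x : realization R K x -> normalize (cone_weights 0 x) = x.
Proof.
move=> [x0 x1 _].
have -> : cone_weights 0 x = x.
  apply/rowP => v; rewrite mxE mxE subr0 (max_idPr (x0 v)).
  suff -> : apex_weights 0 (realization_map f x) 0 v = 0 by rewrite addr0.
  apply/eqP; rewrite eq_le apex_weights_ge0 andbT leNgt; apply/negP.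
  by move=> /apex_weights_gt0P[s [_ _ /level_weight_gt0P[]]]; rewrite ltxx.
by rewrite /normalize x1 invr1 scale1r.
Qed.

Lemma cone_weights1 x : realization R K x ->
  normalize (cone_weights 1 x) = homotopy_inverse (realization_map f x).
Proof.
move=> xK; rewrite /homotopy_inverse; congr normalize.
apply/rowP => v; rewrite mxE.
suff -> : truncation 1 x 0 v = 0 by rewrite add0r.
apply/eqP; rewrite eq_le truncation_ge0 andbT leNgt truncation_gt0 -leNgt.
exact: realization_le1 xK.
Qed.

(** Normalized [cone_weights c], with [c] going from 1 to 0, joins the composite
    on [K] to the identity; segments do so on [L]. *)
Theorem conical_fibers_equivalence :
  homotopy_equivalence R (realization R K) (realization R L)
    (realization_map f).
Proof.
have fKL := realization_map_fun (R := R) f_simplicial.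
split.
  split=> //; apply: continuous_subspaceT => x.
  exact: (cvg_realization_map (F := nbhs x) (g := id)).
exists homotopy_inverse; split.
- split; first exact: homotopy_inverse_fun.
  apply: continuous_in_subspaceT => y; rewrite inE => yL.
  exact: (cvg_homotopy_inverse (F := nbhs y) (g := id)).
- exists (fun z => normalize (cone_weights (1 - z.1) z.2)).
  split=> [|x xK|x xK] /=.
  + have dom z : ((`[0, 1] : set R) `*` realization R K) z ->
        0 <= 1 - z.1 /\ realization R K z.2.
      by case=> /=; rewrite in_itv /= => /andP[_ z1] ?; rewrite subr_ge0.
    split=> [z /dom[z1 zK]|].
      apply: (@normalize_realization _ _ _ _
        [set v | 0 < cone_weights (1 - z.1) z.2 0 v]%SET).
      * exact: cone_weights_ge0.
      * exact: exists_cone_weight_gt0.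
      * by apply: K_flag => u v; rewrite !inE; exact: cone_weights_clique.
      * by move=> v; rewrite inE.
    apply: continuous_in_subspaceT => z; rewrite inE => /dom[z1 zK].
    apply: (cvg_normalize (F := nbhs z)).
    * exact: cone_weights_ge0.
    * exact: exists_cone_weight_gt0.
    * apply: cvg_cone_weights; last exact: cvg_snd.
      by apply: cvgB; [exact: cvg_cst|exact: cvg_fst].
  + by rewrite subr0 cone_weights1.
  + by rewrite subrr cone_weights0.
- exists (fun z =>
    (1 - z.1) *: realization_map f (homotopy_inverse z.2) + z.1 *: z.2).
  split=> [|y yL|y yL] /=.
  + split=> [[t y] [/= t01 yL]|].
      apply: realization_convex => //.
      * exact/fKL/homotopy_inverse_fun.
      * exact: homotopy_inverse_supp.
    apply: continuous_in_subspaceT => -[t y]; rewrite inE => -[/= _ yL].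
    apply: cvgD; apply: cvgZ; rewrite /=.
    * by apply: cvgB; [exact: cvg_cst|exact: cvg_fst].
    * apply: cvg_realization_map; apply: cvg_homotopy_inverse => //.
      exact: cvg_snd.
    * exact: cvg_fst.
    * exact: cvg_snd.
  + by rewrite subr0 scale1r scale0r addr0.
  + by rewrite subrr scale0r scale1r add0r.
Qed.

End ConicalFibers.

(** * Arcs and their preimages *)

Local Open Scope nat_scope.

(** With residues represented by numbers below [N], an arc that starts at [i] is
    a segment, followed by an initial segment if it passes [N]. If it wraps around
    several times, the second condition holds for every [v]. *)
Lemma mem_circ_arc N k (i v : 'I_N) :
  (v \in circ_arc N i (i + k)) = (i <= v <= i + k) || (v + N <= i + k).
Proof.
have vN := ltn_ord v; have iN := ltn_ord i.
rewrite inE; apply/hasP/idP => [[x]|/orP[h|h]].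
- rewrite mem_index_iota ltnS => /andP[ix xk] /eqP; rewrite (modn_small vN).
  by move=> xv; have := divn_eq x N; rewrite xv; case: (x %/ N) => [|q]; nia.
- by exists (v : nat); rewrite ?mem_index_iota ?ltnS.
- exists (v + N); last by rewrite modnDr.
  by rewrite mem_index_iota; lia.
Qed.

Lemma mem_circ_arc_mod n k (i : nat) (v : 'I_n) d : d <= k ->
  i + d = v %[mod n] -> v \in circ_arc n (i %% n) (i %% n + k).
Proof.
move=> dk idv; rewrite inE; apply/hasP; exists (i %% n + d).
  by rewrite mem_index_iota; lia.
by rewrite modnDml idv.
Qed.

Section ClosedNeighbours.
Variables (n k : nat) (n_gt0 : 0 < n).

(** Adjacency means cyclic distance at most [k]. The way from [u] to [v] through
    0 in the cycle of length [n + k] is at most [k] when [u + n <= v]. *)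
Lemma edge_clique_nerve (u v : 'I_(n + k)) :
  ([set u; v]%SET \in clique_nerve (n + k) k) =
  [|| (u <= v + k) && (v <= u + k), u + n <= v | v + n <= u].
Proof.
have un := ltn_ord u; have vn := ltn_ord v.
rewrite clique_complex_edge inE; apply/existsP/idP => [[i]|].
  rewrite finset.subUset !finset.sub1set !mem_circ_arc; have := ltn_ord i; lia.
have mem i :
    (u \in circ_arc (n + k) i (i + k)) && (v \in circ_arc (n + k) i (i + k)) ->
    [set u; v]%SET \subset circ_arc (n + k) i (i + k).
  by rewrite finset.subUset !finset.sub1set.
have [uv|vu] := leqP u v => h.
  have [vuk|] := leqP v (u + k); [exists u|exists v]; apply: mem;
  rewrite !mem_circ_arc; lia.
have [uvk|] := leqP u (v + k); [exists v|exists u]; apply: mem;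
rewrite !mem_circ_arc; lia.
Qed.

Let f : 'I_(n + k) -> 'I_n := residue n_gt0.

(** With [a] the least element of a clique, the image lies in the arc that
    starts at [a]: an element within [k] of [a] goes there, and one at least [n]
    above [a] goes to the same residue as it does after subtracting [n], which
    leaves it less than [k] above [a]. *)
Lemma residue_simplicial :
  simplicial_map (clique_nerve (n + k) k) (nerve n k) f.
Proof.
move=> s sK; rewrite inE; apply/existsP.
have [->|/finset.set0Pn[v0 sv0]] := eqVneq s finset.set0.
  by exists (Ordinal n_gt0); rewrite finset.imset0 finset.sub0set.
have [a sa amin] := arg_minnP (fun v : 'I_(n + k) => v : nat) sv0.
exists (f a); apply/fintype.subsetP => _ /imsetP[v sv ->] /=.
have: [set a; v]%SET \in clique_nerve (n + k) k.
  apply: face_simplex sK; apply/fintype.subsetP => w.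
  by rewrite !inE => /orP[]/eqP->.
rewrite edge_clique_nerve; have av := amin _ sv; have vn := ltn_ord v.
have [vk _|vk h] := leqP v (a + k).
  apply: (@mem_circ_arc_mod _ _ _ _ (v - a)) => /=; first by lia.
  by rewrite modn_mod subnKC.
apply: (@mem_circ_arc_mod _ _ _ _ (v - n - a)) => /=; first by lia.
by rewrite modn_mod -[in RHS](@subnK n v) ?modnDr ?subnKC //; lia.
Qed.

(** An arc [i], ..., [i + k] with [i < n] fits into [0], ..., [n + k - 1]
    without wrapping, and there it is a clique. *)
Lemma nerve_simplex_lift (t : {set 'I_n}) : t \in nerve n k ->
  exists2 s, s \in clique_nerve (n + k) k & (f @: s = t)%SET.
Proof.
rewrite inE => /existsP[i /fintype.subsetP ti]; have iN := ltn_ord i.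
exists [set v : 'I_(n + k) | (i <= v <= i + k) && (f v \in t)]%SET.
  apply: clique_complex_flag => u v; rewrite [u \in _]inE [v \in _]inE.
  by rewrite -/(clique_nerve (n + k) k) edge_clique_nerve; lia.
apply/setP => j; apply/imsetP/idP => [[v]|tj].
  by rewrite inE => /andP[_ ?] ->.
have := ti j tj; rewrite mem_circ_arc; have jn := ltn_ord j => /orP[h|h].
  have vn : j < n + k by lia.
  have fv : f (Ordinal vn) = j by apply: val_inj; rewrite /= modn_small.
  by exists (Ordinal vn); rewrite // inE fv tj /=; lia.
have vn : j + n < n + k by lia.
have fv : f (Ordinal vn) = j by apply: val_inj; rewrite /= modnDr modn_small.
by exists (Ordinal vn); rewrite // inE fv tj /=; lia.
Qed.

(** Let [s] be inside the arc of [i]. Suppose first that [j + n <= i + k] for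
    some vertices [j] of [s], of which [b] is the largest. The apex is [b + n]: a
    vertex [v >= n] over [s] is within [k] of it because both are between [n] and
    [n + k]; a vertex [v < n] is itself in [s], and either [v <= b], so that the
    difference is at least [n], or [i <= v], so that
    [b + n <= i + k <= v + k]. Otherwise [s] lies between [i] and [i + k], and
    the apex is its least element [b]: a vertex [v < n] over [s] is in [s], hence
    between [b] and [b + k], and a vertex [v >= n] is at least [b + n]. *)
Lemma residue_fiber_apex (s : {set 'I_n}) :
  s \in nerve n k -> s != finset.set0 ->
  exists a, f a \in s /\
    forall v, f v \in s -> [set v; a]%SET \in clique_nerve (n + k) k.
Proof.
rewrite inE => /existsP[i /fintype.subsetP si] /finset.set0Pn[j0 sj0].
have iN := ltn_ord i.
have fE (v : 'I_(n + k)) : v < n -> f v = v :> nat.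
  by move=> vn; rewrite /= modn_small.
have fS (v : 'I_(n + k)) : n <= v -> f v + n <= v.
  move=> nv; rewrite /= [X in _ <= X](divn_eq v n).
  by have := divn_gt0 v n_gt0; rewrite nv; nia.
have arc j : j \in s -> (i <= j <= i + k) || (j + n <= i + k).
  by move=> /si; rewrite mem_circ_arc.
case: (pickP [pred j in s | j + n <= i + k]) => [j1 hj1|nowrap].
  have [b /andP[sb bk] bmax] := arg_maxnP (fun j : 'I_n => j : nat) hj1.
  have an : b + n < n + k by lia.
  exists (Ordinal an); split.
    suff -> : f (Ordinal an) = b by [].
    by apply: val_inj; rewrite /= modnDr modn_small.
  move=> v sv; rewrite edge_clique_nerve /=; have vN := ltn_ord v.
  have [vn|nv] := ltnP v n; last by have := ltn_ord b; lia.
  have := arc _ sv; have := bmax (f v).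
  by rewrite inE sv fE //=; lia.
have [b sb bmin] := arg_minnP (fun j : 'I_n => j : nat) sj0.
have an : b < n + k by have := ltn_ord b; lia.
exists (Ordinal an); split.
  by suff -> : f (Ordinal an) = b by []; apply: val_inj; rewrite /= modn_small.
have {}arc j : j \in s -> i <= j <= i + k.
  move=> sj; have := arc j sj; have := nowrap j.
  by rewrite /= sj /= => ->; rewrite orbF.
move=> v sv; rewrite edge_clique_nerve /=; have bv := bmin _ sv.
have := arc _ sv; have := arc _ sb.
by have [vn|nv] := ltnP v n; [rewrite fE // in bv *|have := fS v nv]; lia.
Qed.

End ClosedNeighbours.

Theorem theorem8p5 (R : realType) (n k : nat) (n_gt0 : (0 < n)%N) :
  let f : 'I_(n + k) -> 'I_n := residue n_gt0 in
  let realf : 'rV[R]_(n + k) -> 'rV[R]_n := realization_map f in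
  let K := clique_nerve (n + k) k in
  let L := nerve n k in
  [/\ simplicial_map K L f,
      set_surj (realization R K) (realization R L) realf
    & homotopy_equivalence R (realization R K) (realization R L) realf].
Proof.
move=> f realf K L.
have fKL : simplicial_map K L f by exact: residue_simplicial.
split=> //.
  by apply: realization_map_surj => t; exact: nerve_simplex_lift.
have /boolp.choice[p apexP] : forall s : {set 'I_n}, exists a : 'I_(n + k),
    s \in L -> s != finset.set0 ->
    f a \in s /\ forall v, f v \in s -> [set v; a]%SET \in K.
  move=> s.
  have [sL|sL] := boolP ((s \in L) && (s != finset.set0)).
    have /andP[sL' s0] := sL.
    by have [a ?] := residue_fiber_apex n_gt0 sL' s0; exists a.
  (* Off the nonempty simplices of [L] the apex is a default value. *)
  exists (Ordinal (ltn_addr k n_gt0)) => sL' s0.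
  by rewrite sL' s0 in sL.
apply: (@conical_fibers_equivalence _ _ _ _ _ _ p) => //.
- exact: clique_complex_flag.
- by move=> s sL s0; have [] := apexP s sL s0.
- move=> s v sL vs; apply: (apexP s sL _).2 => //.
  by apply/finset.set0Pn; exists (f v).
Qed.
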